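(* There exist infinitely many positive integers $n$ such that the following holds. Consider the problem of approximating $R_G(s,t)$, where the input is an $n$-vertex unweighted undirected graph $G=(V,E)$ together with two adjacent vertices $s,t$ (i.e. $(s,t)\in E$), and where every vertex of $G$ other than $s$ and $t$ has degree at most $3$. Then any local algorithm (in the adjacency list model) which, on every such input, outputs a $1.01$-approximation of $R_G(s,t)$ with probability at least $0.6$ must make $\Omega(n)$ queries.
   Context: For an unweighted undirected graph $G$ with Laplacian $L_G=D_G-A_G$ ($D_G$ the degree diagonal matrix, $A_G$ the adjacency matrix) and pseudo-inverse $L_G^{\dagger}$, the effective resistance between vertices $s,t$ is $R_G(s,t)=(\mathbf{1}_s-\mathbf{1}_t)^{\top}L_G^{\dagger}(\mathbf{1}_s-\mathbf{1}_t)$, where $\mathbf{1}_u$ is the indicator vector of $u$. For $C>1$, a value $a$ is a $C$-approximation of a value $b$ if $a\in[b/C,b]$. In the adjacency list model, a local algorithm accesses the graph only through the following constant-time queries: a degree query (returns the degree of a given vertex $v$), a neighbor query (returns the $i$-th neighbor of a given vertex $v$), and uniform sampling (returns a uniformly random vertex of $V$); its query complexity is the number of such queries made. *)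

(* Defs.v *)
From HB Require Import structures.
From mathcomp Require Import all_boot all_order all_algebra.
From mathcomp Require Import all_classical all_reals all_analysis.
Set Implicit Arguments.
Unset Strict Implicit.
Unset Printing Implicit Defensive.
Import Order.TTheory GRing.Theory Num.Theory.
Local Open Scope ring_scope.

(* A simple undirected graph on the vertex set 'I_n, presented by its adjacency
   lists. The order inside each list is an arbitrary part of the presentation;
   it is visible to neighbor queries only. *)
Record graph (n : nat) := Graph {
  nbrs : 'I_n -> seq 'I_n;
  nbrs_uniq : forall v, uniq (nbrs v);
  nbrs_irrefl : forall v, v \notin nbrs v;
  nbrs_sym : forall u v, (v \in nbrs u) = (u \in nbrs v) }.

Definition edge (n : nat) (G : graph n) : rel 'I_n := fun u v => v \in nbrs G u.

Definition deg (n : nat) (G : graph n) (v : 'I_n) : nat := size (nbrs G v).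

Definition adjacency (R : realType) (n : nat) (G : graph n) : 'M[R]_n :=
  \matrix_(i, j) (edge G i j)%:R.

Definition laplacian (R : realType) (n : nat) (G : graph n) : 'M[R]_n :=
  diag_mx (\row_i (deg G i)%:R) - adjacency R G.

(* The four Penrose conditions. MathComp's pinvmx is only a one-sided partial
   inverse, not the Moore-Penrose pseudo-inverse. *)
Definition penrose (R : realType) (m n : nat)
    (A : 'M[R]_(m, n)) (B : 'M[R]_(n, m)) : Prop :=
  [/\ A *m B *m A = A, B *m A *m B = B,
      (A *m B)^T = A *m B & (B *m A)^T = B *m A].

Lemma penrose_unique (R : realType) (m n : nat)
    (A : 'M[R]_(m, n)) (B C : 'M[R]_(n, m)) :
  penrose A B -> penrose A C -> B = C.
Proof.
move=> [aba bab abT baT] [aca cac acT caT].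
have eAB : A *m B = A *m C.
  rewrite -abT -{1}aca -mulmxA trmx_mul abT acT mulmxA.
  by rewrite -!mulmxA (mulmxA A B) (mulmxA (A *m B)) aba.
have eBA : B *m A = C *m A.
  rewrite -baT -{1}aca -!mulmxA mulmxA trmx_mul caT baT.
  by rewrite -mulmxA (mulmxA A B) aba.
by rewrite -bab -mulmxA eAB mulmxA eBA cac.
Qed.

Lemma gram_unit (R : realType) (m n : nat) (F : 'M[R]_(m, n)) :
  row_free F -> F *m F^T \in unitmx.
Proof.
move=> fF; rewrite -row_free_unit; apply: inj_row_free => v.
rewrite mulmxA => vFF0; apply/(row_free_inj fF); rewrite mul0mx.
have /matrixP/(_ 0 0) : v *m F *m (v *m F)^T = 0.
  by rewrite trmx_mul mulmxA vFF0 mul0mx.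
rewrite !mxE => /eqP; rewrite psumr_eq0 => [/allP sq0|j _]; last first.
  by rewrite [_^T _ _]mxE -expr2 sqr_ge0.
apply/rowP => j; have := sq0 j (mem_index_enum j).
by rewrite [_^T _ _]mxE -expr2 sqrf_eq0 [RHS]mxE => /eqP.
Qed.

Lemma penrose_exists (R : realType) (m n : nat) (A : 'M[R]_(m, n)) :
  exists B, penrose A B.
Proof.
have := mulmx_base A; have := row_base_free A; have := col_base_full A.
move: (col_base A) (row_base A) => C F fC fF eA.
have uF : F *m F^T \in unitmx by exact: gram_unit.
have uC : C^T *m C \in unitmx.
  rewrite -{2}[C]trmxK; apply: gram_unit.
  by rewrite /row_free mxrank_tr.
pose P := F^T *m invmx (F *m F^T); pose Q := invmx (C^T *m C) *m C^T.
have FP : F *m P = 1%:M by rewrite /P mulmxA mulmxV.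
have QC : Q *m C = 1%:M by rewrite /Q -mulmxA mulVmx.
have eAB : A *m (P *m Q) = C *m Q.
  by rewrite -[X in X *m _]eA -mulmxA (mulmxA F) FP mul1mx.
have eBA : P *m Q *m A = P *m F.
  by rewrite -[X in _ *m X]eA -mulmxA (mulmxA Q) QC mul1mx.
exists (P *m Q); split.
- by rewrite eAB -[X in _ *m X]eA -mulmxA (mulmxA Q) QC mul1mx eA.
- by rewrite eBA -mulmxA (mulmxA F) FP mul1mx.
- by rewrite eAB /Q !trmx_mul trmx_inv trmx_mul !trmxK mulmxA.
- by rewrite eBA /P !trmx_mul trmx_inv trmx_mul !trmxK mulmxA.
Qed.

(* The default value 0 is never used, by penrose_exists. *)
Definition pseudoinverse (R : realType) (m n : nat) (A : 'M[R]_(m, n)) :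
    'M[R]_(n, m) :=
  xget 0 [set B | penrose A B]%classic.

Lemma pseudoinverseP (R : realType) (m n : nat) (A : 'M[R]_(m, n)) :
  penrose A (pseudoinverse A).
Proof. by have := penrose_exists A; exact: xgetPex. Qed.

Definition effective_resistance (R : realType) (n : nat) (G : graph n)
    (s t : 'I_n) : R :=
  let x : 'cV[R]_n := delta_mx s 0 - delta_mx t 0 in
  (x^T *m pseudoinverse (laplacian R G) *m x) 0 0.

Definition approximates (R : realType) (C a b : R) : Prop := b / C <= a <= b.

(* A query algorithm whose only randomness is the answers to sampling queries:
   after each answer it continues adaptively, and it finally outputs a real
   number. Any vertex name may be queried, and computation between queries is
   unrestricted and free of charge. *)
Inductive qtree (R : realType) (n : nat) : Type :=
| Output of R
| DegreeQuery of 'I_n & (nat -> qtree R n)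
| NeighborQuery of 'I_n & nat & (option 'I_n -> qtree R n)
| SampleQuery of ('I_n -> qtree R n).

(* Probability, over the uniform and independent answers to the sampling
   queries, that the output on G lies in B. Neighbor indices start at 0, and the
   answer is None when the index is at least the degree. *)
Fixpoint tree_prob (R : realType) (n : nat) (G : graph n) (B : set R)
    (a : qtree R n) : R :=
  match a with
  | Output x => \1_B x
  | DegreeQuery v k => tree_prob G B (k (deg G v))
  | NeighborQuery v i k => tree_prob G B (k (onth (nbrs G v) i))
  | SampleQuery k => n%:R^-1 * \sum_(u < n) tree_prob G B (k u)
  end.

(* Largest number of queries made on G, over all answers to the sampling
   queries. *)
Fixpoint tree_queries (R : realType) (n : nat) (G : graph n)
    (a : qtree R n) : nat :=
  match a with
  | Output _ => 0
  | DegreeQuery v k => (tree_queries G (k (deg G v))).+1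
  | NeighborQuery v i k => (tree_queries G (k (onth (nbrs G v) i))).+1
  | SampleQuery k => (\max_(u < n) tree_queries G (k u)).+1
  end.

(* A randomized local algorithm for n-vertex graphs: internal randomness is a
   seed drawn from an arbitrary probability space, and the pair (s, t) is given
   as explicit input. The measurability condition says only that the output has
   a well-defined law on each input. *)
Record local_algorithm (R : realType) (n : nat) := LocalAlgorithm {
  seed_display : measure_display;
  seed : measurableType seed_display;
  seed_law : probability seed R;
  run : 'I_n -> 'I_n -> seed -> qtree R n;
  run_measurable : forall (G : graph n) (s t : 'I_n) (B : set R),
    measurable B ->
    measurable_fun [set: seed] (fun w => tree_prob G B (run s t w)) }.

Definition output_prob (R : realType) (n : nat) (A : local_algorithm R n)
    (G : graph n) (s t : 'I_n) (B : set R) : \bar R :=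
  (\int[seed_law A]_w (tree_prob G B (run s t w))%:E)%E.

Definition is_instance (n : nat) (G : graph n) (s t : 'I_n) : Prop :=
  edge G s t /\ forall v, v != s -> v != t -> (deg G v <= 3)%N.

Definition solves (R : realType) (n : nat) (C p : R)
    (A : local_algorithm R n) : Prop :=
  forall (G : graph n) (s t : 'I_n), is_instance G s t ->
    (p%:E <= output_prob A G s t
               [set a | approximates C a (effective_resistance R G s t)]%classic)%E.

(* Worst-case query complexity at least q: some instance and some outcome of all
   the randomness lead to at least q queries. *)
Definition makes_queries (R : realType) (n : nat) (A : local_algorithm R n)
    (q : R) : Prop :=
  exists (G : graph n) (s t : 'I_n) (w : seed A),
    is_instance G s t /\ q <= (tree_queries G (run s t w))%:R.

(* Main.v *)
(* Take two stars of equal size whose centers s and t are joined: there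
   R(s,t) = 1. Joining one leaf of s to one leaf of t adds a parallel path of
   length 3 and drops R(s,t) to 3/4, too far to be covered by a common
   1.01-approximation. Only a query at one of these two leaves reveals the added
   edge. With m disjoint candidate pairs and q queries on the base graph, the m
   success probabilities on the modified graphs therefore sum to at most
   m * (1 - 0.6) + q, while each is at least 0.6, so q >= 0.2 m. *)

Require Import Defs.
From mathcomp Require Import all_boot all_order all_algebra.
From mathcomp Require Import all_classical all_reals all_analysis.
From mathcomp Require Import measurable_realfun ring lra zify.
Import Order.TTheory GRing.Theory Num.Theory.
Local Open Scope ring_scope.

(** * Effective resistance from potentials *)

Lemma laplacian_mulE (R : realType) n (G : graph n) (f : 'cV[R]_n) u :
  (laplacian R G *m f) u 0 = \sum_(w | edge G u w) (f u 0 - f w 0).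
Proof.
rewrite /laplacian mulmxBl mxE mul_diag_mx !mxE sumrB; congr (_ - _).
  rewrite sumr_const mulr_natl; congr (_ *+ _).
  exact/esym/card_uniqP/nbrs_uniq.
rewrite [RHS]big_mkcond; apply: eq_bigr => w _; rewrite mxE.
by case: (edge G u w); rewrite (mul1r, mul0r).
Qed.

Lemma laplacian_sym (R : realType) n (G : graph n) :
  (laplacian R G)^T = laplacian R G.
Proof.
apply/matrixP => i j; rewrite !mxE /edge nbrs_sym eq_sym.
by case: eqP => [->|]; rewrite ?mulr1n ?mulr0n.
Qed.

(** Writing [x = L f] with [L] symmetric, the first Penrose condition turns the quadratic form of
    the pseudo-inverse into [f^T L f = f^T x]. Exhibiting a potential of the unit current thus
    replaces computing the pseudo-inverse. *)
Lemma effective_resistance_potential (R : realType) n (G : graph n) s t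
    (f : 'cV[R]_n) :
  laplacian R G *m f = delta_mx s 0 - delta_mx t 0 ->
  effective_resistance R G s t = f s 0 - f t 0.
Proof.
move=> Lf; rewrite /effective_resistance /= -Lf.
have [eL _ _ _] := pseudoinverseP (laplacian R G).
rewrite trmx_mul laplacian_sym !mulmxA -(mulmxA f^T) -(mulmxA f^T) eL.
rewrite -mulmxA Lf mulmxBr !mxE; congr (_ - _).
  rewrite (bigD1 s) //= !mxE !eqxx mulr1 big1 ?addr0 // => j /negPf js.
  by rewrite !mxE js mulr0.
rewrite (bigD1 t) //= !mxE !eqxx mulr1 big1 ?addr0 // => j /negPf jt.
by rewrite !mxE jt mulr0.
Qed.

Lemma sum_two_terms (R : nmodType) (T : finType) (P : pred T) (F : T -> R) a b :
  a != b -> P a -> P b -> (forall w, P w -> w != a -> w != b -> F w = 0) ->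
  \sum_(w | P w) F w = F a + F b.
Proof.
move=> ab Pa Pb F0; rewrite (bigD1 a) //= (bigD1 b) ?Pb 1?eq_sym //=.
by rewrite big1 ?addr0 // => w /andP[/andP[Pw wa] wb]; exact: F0.
Qed.

(** * Success probabilities of query trees, for one seed and on average *)

Lemma tree_prob_ge0 (R : realType) n (G : graph n) (B : set R) a :
  0 <= tree_prob G B a.
Proof.
elim: a => [x|v k IH|v i k IH|k IH] //=.
by rewrite mulr_ge0 // sumr_ge0.
Qed.

Lemma tree_prob_disjoint (R : realType) n (G : graph n) (B C : set R) a :
  (0 < n)%N -> [disjoint B & C]%classic ->
  tree_prob G B a + tree_prob G C a <= 1.
Proof.
move=> n0 /disj_setPS BC; elim: a => [x|v k IH|v i k IH|k IH] //=.
  rewrite !indicE; case: (boolP (x \in B)) => xB; case: (boolP (x \in C)) => xC;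
    rewrite ?addr0 ?add0r //.
  by have [] := BC x; split; exact: set_mem.
rewrite -mulrDr -big_split /= mulrC ler_pdivrMr ?ltr0n // mul1r.
rewrite (le_trans (ler_sum _ (fun u _ => IH u))) //.
by rewrite sumr_const card_ord.
Qed.

Lemma tree_prob_le1 (R : realType) n (G : graph n) (B : set R) a :
  (0 < n)%N -> tree_prob G B a <= 1.
Proof.
move=> n0; apply: le_trans (@tree_prob_disjoint R n G B set0 a n0 _).
  by rewrite lerDl tree_prob_ge0.
by rewrite disj_set_sym; apply/disj_setPS; rewrite set0I.
Qed.

(* Sampling is blind to the edges, so only degree and neighbor queries tell the
   graphs H i apart from G, and each of them reveals at most one index i. *)
Lemma sum_tree_prob_le (R : realType) n (G : graph n) (I : finType)
    (H : I -> graph n) (B : set R) a :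
  (0 < n)%N ->
  (forall v i j, nbrs (H i) v <> nbrs G v -> nbrs (H j) v <> nbrs G v ->
    i = j) ->
  \sum_i tree_prob (H i) B a <=
    #|I|%:R * tree_prob G B a + (tree_queries G a)%:R.
Proof.
move=> n0 HG.
(* One degree or neighbor query at [v]: [F] is the probability before it and [K] that of the
   continuation after the answer given by [G]. They differ for at most one [i], where [F i <= 1] is
   paid for by the query itself. *)
have step v (F : I -> R) (K : I -> R) (c : R) (q : nat) :
    (forall i, nbrs (H i) v = nbrs G v -> F i = K i) ->
    (forall i, F i <= 1) -> (forall i, 0 <= K i) ->
    \sum_i K i <= c + q%:R -> \sum_i F i <= c + q.+1%:R.
  move=> FK F1 K0 Kle.
  have [i iv|Hv] := pickP (fun i => nbrs (H i) v != nbrs G v); last first.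
    rewrite (eq_bigr K) => [|i _]; last by apply/FK/eqP/negbFE/Hv.
    by rewrite (le_trans Kle) // lerD2l ler_nat.
  rewrite -natr1 addrA (bigD1 i) //= addrC lerD //.
  rewrite (le_trans _ Kle) // [leRHS](bigD1 i) //= -[leLHS]add0r lerD //.
  apply: ler_sum => j ji; rewrite FK //; apply: contrapT => jv.
  by case/eqP: ji; apply: (HG v) => //; exact/eqP.
elim: a => [x|v k IH|v j k IH|k IH] /=.
- by rewrite sumr_const addr0 mulr_natl.
- apply: (step v _ (fun i => tree_prob (H i) B (k (deg G v)))) => // i.
  + by rewrite /deg => ->.
  + exact: tree_prob_le1.
  + exact: tree_prob_ge0.
- apply: (step v _ (fun i => tree_prob (H i) B (k (onth (nbrs G v) j)))) => // i.
  + by move=> ->.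
  + exact: tree_prob_le1.
  + exact: tree_prob_ge0.
(* A sample has the same law on all the graphs, so the inductive bounds are averaged over [u], with
   each query count bounded by the maximum [Q]. *)
- set Q := \max_(u < n) _; rewrite -mulr_sumr exchange_big /= mulrCA.
  rewrite -[Q.+1%:R](mulKf (x := n%:R)) ?pnatr_eq0 -?lt0n // -mulrDr.
  rewrite ler_pM2l ?invr_gt0 ?ltr0n //.
  have ub u : \sum_i tree_prob (H i) B (k u) <=
      #|I|%:R * tree_prob G B (k u) + Q.+1%:R.
    rewrite (le_trans (IH u)) // lerD2l ler_nat ltnW // ltnS.
    exact: leq_bigmax.
  rewrite (le_trans (ler_sum _ (fun u _ => ub u))) // big_split /= -mulr_sumr.
  by rewrite lerD2l sumr_const card_ord mulr_natl.
Qed.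

(** By linearity of expectation and total mass 1, a bound on the sum that holds for every seed also
    holds for the expected values. *)
Lemma integral_sum_ge (R : realType) d (T : measurableType d)
    (P : probability T R) (J : finType) (h : J -> T -> R) (p M : R) :
  (forall j, measurable_fun [set: T] (h j)) -> (forall j w, 0 <= h j w) ->
  (forall j, p%:E <= \int[P]_w (h j w)%:E)%E ->
  (forall w, \sum_j h j w <= M) -> #|J|%:R * p <= M.
Proof.
move=> mh h0 hp hM; rewrite -lee_fin.
have -> : (#|J|%:R * p)%:E = (\sum_(j : J) p%:E)%E.
  by rewrite sumEFin sumr_const mulr_natl.
apply: (le_trans (lee_sum _ (fun j _ => hp j))).
rewrite -ge0_integral_sum //; last 2 first.
- by move=> j; exact/measurable_EFinP.
- by move=> j w _; rewrite lee_fin.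
rewrite -[leRHS]mule1 -(@probability_setT _ _ _ P) -integral_cst //.
apply: ge0_le_integral => //.
- by move=> w _; rewrite sume_ge0 // => j _; rewrite lee_fin.
- by apply: emeasurable_sum => j; exact/measurable_EFinP.
- by move=> w _; rewrite sumEFin lee_fin.
Qed.

(** * The two-star graphs and their resistances *)

(* s = 0 is joined to t = 1 and to all even vertices, t to all odd vertices;
   p > 0 adds the edge between the leaves 2p and 2p+1, p = 0 adds nothing since
   the edge between 0 and 1 is already there. *)
Definition two_stars_rel (p u v : nat) : bool :=
  (u != v) && ((odd u == odd v) && ((u < 2) || (v < 2)) ||
               (u./2 == v./2) && ((u./2 == p) || (u./2 == 0)))%N.

Lemma two_stars_rel_sym p u v : two_stars_rel p u v = two_stars_rel p v u.
Proof. by rewrite /two_stars_rel; lia. Qed.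

Definition two_stars n (p : nat) : graph n.
Proof.
refine (@Graph n (fun u => [seq v : 'I_n <- enum 'I_n | two_stars_rel p u v]) _ _ _).
- by move=> u; rewrite filter_uniq // enum_uniq.
- by move=> u; rewrite mem_filter /two_stars_rel eqxx.
- by move=> u v; rewrite mem_filter mem_enum mem_filter mem_enum two_stars_rel_sym.
Defined.

Lemma edge_two_stars n p u v : edge (two_stars n p) u v = two_stars_rel p u v.
Proof. by rewrite /edge mem_filter mem_enum andbT. Qed.

Lemma two_stars_resistance0 (R : realType) n (s t : 'I_n) :
  s = 0%N :> nat -> t = 1%N :> nat ->
  effective_resistance R (two_stars n 0) s t = 1.
Proof.
move=> s0 t1; have st : s != t by rewrite -val_eqE /= s0 t1.
(* Every edge other than [st] joins vertices of equal parity, so the whole unit current crosses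
   [st]. *)
pose f : 'cV[R]_n := \col_u (~~ odd u)%:R.
rewrite (@effective_resistance_potential _ _ _ _ _ f); last first.
  apply/colP => u; rewrite laplacian_mulE !mxE !eqxx !andbT.
  rewrite (eq_bigl _ _ (edge_two_stars _ 0 u)).
  have [->|us] := eqVneq u s.
    rewrite (negbTE st) (bigD1 t) /=; last by rewrite s0 t1.
    rewrite big1 ?addr0 => [|w /andP[sw wt]]; rewrite !mxE s0 ?t1 //.
    move: sw wt; rewrite -val_eqE /= s0 t1 /two_stars_rel => sw wt.
    have -> : odd w = false by lia.
    by rewrite subrr.
  have [->|ut] := eqVneq u t.
    rewrite (bigD1 s) /=; last by rewrite s0 t1.
    rewrite big1 ?addr0 => [|w /andP[tw ws]]; rewrite !mxE t1 ?s0 //.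
    move: tw ws; rewrite -val_eqE /= s0 t1 /two_stars_rel => tw ws.
    have -> : odd w by lia.
    by rewrite subrr.
  rewrite subrr big1 // => w uw; rewrite !mxE.
  move: us ut uw; rewrite -!val_eqE /= s0 t1 /two_stars_rel => us ut uw.
  have -> : odd w = odd u by lia.
  by rewrite subrr.
by rewrite !mxE s0 t1 subr0.
Qed.

Lemma two_stars_resistance (R : realType) n p (s t a b : 'I_n) :
  (0 < p)%N -> s = 0%N :> nat -> t = 1%N :> nat -> a = p.*2 :> nat ->
  b = p.*2.+1 :> nat -> effective_resistance R (two_stars n p) s t = 3 / 4.
Proof.
move=> p0 s0 t1 ap bp.
(* The edge [st] carries current 3/4 and the path [s], [a], [b], [t] carries 1/4, dropping 1/4 on
   each of its three edges; every other leaf takes the potential of its center. *)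
pose f : 'cV[R]_n := \col_u
  if u == a then 1 / 2 else if u == b then 1 / 4 else
  if odd u then 0 else 3 / 4.
have [st sa sb] : [/\ s != t, s != a & s != b].
  by rewrite -!val_eqE /= s0 t1 ap bp; split; lia.
have [ta tb ab] : [/\ t != a, t != b & a != b].
  by rewrite -!val_eqE /= t1 ap bp; split; lia.
have fs : f s 0 = 3 / 4 by rewrite mxE (negbTE sa) (negbTE sb) s0.
have ft : f t 0 = 0 by rewrite mxE (negbTE ta) (negbTE tb) t1.
have fa : f a 0 = 1 / 2 by rewrite mxE eqxx.
have fb : f b 0 = 1 / 4 by rewrite mxE eq_sym (negbTE ab) eqxx.
have feq (u w : 'I_n) : odd u = odd w -> u != a -> u != b -> w != a -> w != b ->
    f u 0 - f w 0 = 0.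
  move=> uw /negPf ua /negPf ub /negPf wa /negPf wb.
  by rewrite !mxE ua ub wa wb uw subrr.
clearbody f.
rewrite (@effective_resistance_potential _ _ _ _ _ f); last first.
  apply/colP => u; rewrite laplacian_mulE !mxE !eqxx !andbT.
  rewrite (eq_bigl _ _ (edge_two_stars _ p u)).
  have [->|us] := eqVneq u s.
    rewrite (negbTE st) (sum_two_terms _ _ _ _ t a) //.
    - by rewrite fs ft fa /=; lra.
    - by rewrite /two_stars_rel s0 t1; lia.
    - by rewrite /two_stars_rel s0 ap; lia.
    - move=> w sw wt wa; apply: feq => //; move: sw wt wa;
        rewrite /two_stars_rel -!val_eqE /= s0 t1 ap ?bp; lia.
  have [->|ut] := eqVneq u t.
    rewrite (sum_two_terms _ _ _ _ s b) //.
    - by rewrite fs ft fb /=; lra.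
    - by rewrite /two_stars_rel s0 t1; lia.
    - by rewrite /two_stars_rel t1 bp; lia.
    - move=> w tw ws wb; apply: feq => //; move: tw ws wb;
        rewrite /two_stars_rel -!val_eqE /= s0 t1 bp ?ap; lia.
  have [->|ua] := eqVneq u a.
    rewrite subrr (sum_two_terms _ _ _ _ s b) //.
    - by rewrite fs fa fb; lra.
    - by rewrite /two_stars_rel s0 ap; lia.
    - by rewrite /two_stars_rel ap bp; lia.
    - by move=> w; rewrite /two_stars_rel -!val_eqE /= s0 ap bp; lia.
  have [->|ub] := eqVneq u b.
    rewrite subrr (sum_two_terms _ _ _ _ t a) //.
    - by rewrite ft fa fb; lra.
    - by rewrite /two_stars_rel t1 bp; lia.
    - by rewrite /two_stars_rel ap bp; lia.
    - by move=> w; rewrite /two_stars_rel -!val_eqE /= t1 ap bp; lia.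
  rewrite subrr big1 // => w uw; apply: feq => //; move: us ut ua ub uw;
   rewrite /two_stars_rel -!val_eqE /= s0 t1 ap bp; lia.
by rewrite fs ft subr0.
Qed.

Lemma two_stars_instance n p (s t : 'I_n) :
  s = 0%N :> nat -> t = 1%N :> nat -> is_instance (two_stars n p) s t.
Proof.
move=> s0 t1; split; first by rewrite edge_two_stars s0 t1 /two_stars_rel; lia.
move=> v; rewrite -!val_eqE /= s0 t1 => v0 v1.
rewrite /deg -(size_map val).
(* The third entry is the partner of [v], the other number with the same half. *)
apply: (@uniq_leq_size _ _ [:: 0; 1; v./2.*2 + ~~ odd v]%N).
  by rewrite (map_inj_uniq val_inj) filter_uniq // enum_uniq.
move=> _ /mapP[w + ->]; rewrite mem_filter !inE => /andP[+ _].
by rewrite /two_stars_rel /=; lia.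
Qed.

(** Both lists filter the same enumeration, so they agree in order too, which neighbor queries can
    see. *)
Lemma nbrs_two_stars n p (v : 'I_n) :
  v./2 <> p -> nbrs (two_stars n p) v = nbrs (two_stars n 0) v.
Proof.
move=> vp; apply: eq_filter => w; rewrite /two_stars_rel; lia.
Qed.

(** * The linear lower bound *)

Lemma measurable_approximates (R : realType) (C b : R) :
  measurable [set a | approximates C a b]%classic.
Proof.
by rewrite (_ : mkset _ = `[b / C, b]%classic).
Qed.

Theorem theorem1 (R : realType) :
  exists c : R, 0 < c /\
    forall N : nat, exists n : nat, (N < n)%N /\
      forall A : local_algorithm R n,
        solves (101 / 100) (6 / 10) A -> makes_queries A (c * n%:R).
Proof.
(* With [m = N + 1] candidate pairs and two centers, [n = 2m + 2 <= 4m], hence [0.2 m >= n / 20];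
   taking 1/40 makes the final contradiction strict even for [m = 1]. *)
exists (1 / 40); split; first lra.
move=> N; exists (N.*2).+4; split; first lia.
set n := (N.*2).+4 => A solA.
have n0 : (0 < n)%N by [].
pose s : 'I_n := ord0; pose t : 'I_n := inord 1.
have s0 : s = 0%N :> nat by [].
have t1 : t = 1%N :> nat by rewrite inordK.
pose G := two_stars n 0; pose H (i : 'I_N.+1) := two_stars n i.+1.
apply: contrapT => few.
have {}few (w : seed A) : (tree_queries G (run s t w))%:R <= 1 / 40 * n%:R :> R.
  rewrite leNgt; apply/negP => /ltW many; apply: few; exists G, s, t, w.
  by split; first exact: two_stars_instance.
have RG : effective_resistance R G s t = 1 by exact: two_stars_resistance0.
have RH i : effective_resistance R (H i) s t = 3 / 4.
  apply: (@two_stars_resistance _ _ _ _ _ (inord i.+1.*2) (inord i.+1.*2.+1));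
    rewrite // inordK // /n; have := ltn_ord i; lia.
pose B (r : R) := [set a | approximates (101 / 100) a r]%classic.
(* The base graph is counted once per modified graph: for each seed, its [m] copies and the [m]
   modified graphs together have success at most [m + q], against [2m * 0.6] required on average. *)
pose h (j : 'I_N.+1 + 'I_N.+1) (w : seed A) := match j with
  | inl i => tree_prob (H i) (B (3 / 4)) (run s t w)
  | inr _ => tree_prob G (B 1) (run s t w) end.
suff : #|{: 'I_N.+1 + 'I_N.+1}|%:R * (6 / 10) <= N.+1%:R + 1 / 40 * n%:R :> R.
  have -> : n = (N.+1 + N.+1 + 2)%N by rewrite /n; lia.
  rewrite card_sum card_ord !natrD.
  have : (1 : R) <= N.+1%:R by rewrite ler1n.
  lra.
apply: (@integral_sum_ge R _ _ (seed_law A) _ h).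
- by case=> i; apply: run_measurable; exact: measurable_approximates.
- by case=> i w; exact: tree_prob_ge0.
- case=> i /=.
  + have := solA (H i) s t (two_stars_instance _ _ _ _ s0 t1).
    by rewrite /output_prob RH.
  + have := solA G s t (two_stars_instance _ _ _ _ s0 t1).
    by rewrite /output_prob RG.
- move=> w; rewrite big_sumType /= sumr_const.
  (* A changed list at [v] forces [v./2 = i + 1], so [v] determines [i]. *)
  have HG v i j : nbrs (H i) v <> nbrs G v -> nbrs (H j) v <> nbrs G v -> i = j.
    move=> iv jv; apply/val_inj/succn_inj.
    transitivity v./2; apply: contrapT.
      by move=> vi; apply/iv/nbrs_two_stars/nesym.
    by move=> vj; apply/jv/nbrs_two_stars.
  (* Any 1.01-approximation of 1 is at least 100/101, which exceeds 3/4. *)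
  have BB : [disjoint B 1 & B (3 / 4)]%classic.
    apply/disj_setPS => x [/andP[lo _] /andP[_ hi]].
    by clear - lo hi; exfalso; lra.
  have disj := tree_prob_disjoint _ _ G _ _ (run s t w) n0 BB.
  have := sum_tree_prob_le _ _ _ _ H (B (3 / 4)) (run s t w) n0 HG.
  rewrite card_ord -[_ *+ N.+1]mulr_natl.
  have {}disj := ler_wpM2l (ler0n _ N.+1) disj.
  have := few w.
  lra.
Qed.
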